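(* Let $\tau>0$, $\tau\notin\mathbb{Q}$, let $l,k\in\mathbb{Z}_{\ge0}$, and set $\rho=l\tau+k$. Then the zero of $G(\cdot;\tau)$ at $-\rho$ is simple and $$G'(-\rho;\tau)=\frac{1}{\tau\,D_\tau(l,k)},\qquad D_\tau(l,k)=\prod_{j=0}^{k-1}\Gamma\!\left(\frac{j-k}{\tau}-l\right)\prod_{i=0}^{l-1}(2\pi)^{\frac{\tau-1}{2}}\tau^{\frac12+(l-i)\tau}\,\Gamma\big((i-l)\tau\big),$$ where $'$ denotes the derivative with respect to the first argument.
   Context: For $\tau>0$, $G(z;\tau)$ is the Barnes double gamma function: the entire function $G(z;\tau)=\frac{z}{\tau}e^{c_1 z/\tau+c_2 z^2/(2\tau^2)}\prod_{(k,l)\in\mathbb{Z}_{\ge0}^2\setminus\{(0,0)\}}\big(1+\frac{z}{k\tau+l}\big)e^{-\frac{z}{k\tau+l}+\frac{z^2}{2(k\tau+l)^2}}$, with real constants $c_1,c_2$ (depending on $\tau$) uniquely determined by $G(z+1;\tau)=\Gamma(z/\tau)G(z;\tau)$ and $G(z+\tau;\tau)=(2\pi)^{(\tau-1)/2}\tau^{1/2-z}\Gamma(z)G(z;\tau)$. It is normalised by $G(1;\tau)=1$. Empty products equal $1$. *)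

(* Defs.v *)
From Stdlib Require Import Reals Factorial.
From Coquelicot Require Import Coquelicot.

Open Scope R_scope.
Open Scope C_scope.

Definition irrational (x : R) : Prop :=
  ~ exists p q : Z, q <> 0%Z /\ x = (IZR p / IZR q)%R.

(* [Cprod n f] is f 0 * ... * f (n - 1), so [Cprod 0 f] is 1. *)
Fixpoint Cprod (n : nat) (f : nat -> C) : C :=
  match n with
  | O => 1
  | S m => Cprod m f * f m
  end.

(* Coordinatewise limit of a complex sequence; it is the limit in C whenever
   that limit exists, and has no meaning otherwise. *)
Definition Clim_seq (u : nat -> C) : C :=
  (real (Lim_seq (fun n => Re (u n))), real (Lim_seq (fun n => Im (u n)))).

Definition Cexp (z : C) : C :=
  ((exp (Re z) * cos (Im z))%R, (exp (Re z) * sin (Im z))%R).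

(* x ^ w for a real base x > 0: the principal branch exp (w ln x). *)
Definition Rcpow (x : R) (w : C) : C := Cexp (w * ln x).

(* Gauss's product
     Gamma(z) = lim_n  n! n^z / (z (z + 1) ... (z + n)),
   valid for every complex z that is not a nonpositive integer. *)
Definition CGamma (z : C) : C :=
  Clim_seq (fun n =>
    INR (fact n) * Rcpow (INR n) z / Cprod (S n) (fun j => z + INR j)).

Definition Gamma_regular (z : C) : Prop := forall n : nat, z <> - INR n.

Definition lattice (tau : R) (k l : nat) : R := (INR k * tau + INR l)%R.

(* The index (0, 0) is omitted from the product. *)
Definition Barnes_factor (tau : R) (z : C) (k l : nat) : C :=
  match k, l with
  | O, O => 1
  | _, _ =>
      let w := RtoC (lattice tau k l) in
      (1 + z / w) * Cexp (- (z / w) + z ^ 2 / (2 * w ^ 2))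
  end.

(* The double product converges absolutely for tau > 0, so its value is the
   limit of the partial products over the squares 0 <= k, l < N. *)
Definition Barnes_prod (tau : R) (z : C) : C :=
  Clim_seq (fun N => Cprod N (fun k => Cprod N (fun l => Barnes_factor tau z k l))).

Definition BarnesG (tau : R) (c1 c2 : R) (z : C) : C :=
  z / tau * Cexp (c1 * z / tau + c2 * z ^ 2 / (2 * tau ^ 2)) *
  Barnes_prod tau z.

(* The functional equations that determine c1 and c2.  They are equalities of
   meromorphic functions, hence required away from the poles of Gamma. *)
Definition Barnes_constants (tau : R) (c1 c2 : R) : Prop :=
  let G := BarnesG tau c1 c2 in
  (forall z : C, Gamma_regular (z / tau) ->
     G (z + 1) = CGamma (z / tau) * G z) /\
  (forall z : C, Gamma_regular z ->
     G (z + tau) =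
       Rcpow (2 * PI) ((tau - 1) / 2) * Rcpow tau (1 / 2 - z) * CGamma z * G z).

Definition D_tau (tau : R) (l k : nat) : C :=
  Cprod k (fun j => CGamma ((INR j - INR k) / tau - INR l)) *
  Cprod l (fun i =>
    Rcpow (2 * PI) ((tau - 1) / 2) *
    Rcpow tau (1 / 2 + (INR l - INR i) * tau) *
    CGamma ((INR i - INR l) * tau)).

Definition simple_zero (f : C -> C) (a : C) : Prop :=
  f a = 0 /\
  exists d : C, d <> 0 /\ @is_derive C_AbsRing C_NormedModule f a d.

(* Main.v *)
Require Import Defs.
From Stdlib Require Import Reals Factorial Lra Lia Psatz.
From Coquelicot Require Import Coquelicot.

(** The zero at [- rho] is reached from the zero at [0] by walking along the
    functional equations.

    At the origin, [G z = z * h z] where [h z] is [1 / tau] times an exponential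
    times the Weierstrass product [Barnes_prod], and [h] is continuous at [0]
    with [h 0 = 1 / tau] ([zero_with_slope_BarnesG_0]).  The functional equation
    [G (z + s) = g z * G z], with [g] continuous and nonzero at [a], turns a
    factorisation of [G] at [a + s] with slope [d] into one at [a] with slope
    [d / g a] ([zero_with_slope_shift]).  Taking [l] steps with [s = tau] and
    then [k] steps with [s = 1] leads from [0] to [- (l tau + k)], and the values
    of [g] that are met on the way are exactly the factors of [D_tau].  By
    irrationality of [tau], each Gamma factor is evaluated away from the poles.
    A factorisation [f z = (z - a) * h z] with [h] continuous at [a] yields the
    derivative (Caratheodory), so no differentiability of [G] elsewhere, nor of
    Gamma, is needed.

    The analytic input is thus reduced to three facts of continuity type.

    - Gamma is nonzero and continuous at every regular point ([CGamma_neq_0],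
      [CGamma_continuous]).  The ratio of the Gauss sequences at [a + h] and at
      [a] is a finite product of factors
      [exp (h (ln j - ln (j - 1))) / (1 + h / (a + j))], which differ from [1] by
      [O (|h| (1 + |h|) / (j + 1)^2)] ([Gauss_ratio_bound]).  With [a = 1], where
      the sequence is [n / (n + 1)], this gives convergence; with the roles of
      the two points exchanged it bounds the sequence away from [0]; with [h]
      small it gives continuity.

    - [Barnes_prod] is continuous at [0] with value [1].  Its factors differ from
      [1] by [O (|z| / (k + l + 1)^3)], so that every partial product is within
      [exp (A |z|) - 1] of [1], uniformly in the size of the square; this bound
      passes to the limit.

    - A product of factors [f j] with
      [|f j - 1| <= exp (s j - s (j + 1)) - 1] is within [exp (s 0 - s n) - 1]
      of [1] ([Cprod_near_1]).  Stating bounds through such a telescoping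
      potential [s] makes the estimate compose with itself for double products
      and avoids sums of series altogether. *)

Local Open Scope R_scope.

(** * The complex exponential *)

Lemma Cmod_le_Re_Im (z : C) : Cmod z <= Rabs (Re z) + Rabs (Im z).
Proof.
  replace z with (RtoC (Re z) + RtoC (Im z) * Ci)%C at 1.
  - apply Rle_trans with (1 := Cmod_triangle _ _).
    rewrite Cmod_mult, !Cmod_R, Cmod_Ci; lra.
  - destruct z as [x y]; unfold Ci, RtoC, Cmult, Cplus; simpl.
    f_equal; ring.
Qed.

Lemma im_le_Cmod (z : C) : Rabs (Im z) <= Cmod z.
Proof.
  apply Rle_trans with (2 := Rmax_Cmod z). apply Rmax_r.
Qed.

Lemma Cexp_plus (z w : C) : Cexp (z + w)%C = (Cexp z * Cexp w)%C.
Proof.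
  destruct z as [x y], w as [u v]; unfold Cexp, Cmult, Cplus; simpl.
  rewrite exp_plus, cos_plus, sin_plus; f_equal; ring.
Qed.

Lemma Cexp_0 : Cexp 0 = RtoC 1.
Proof. unfold Cexp, RtoC; simpl. rewrite exp_0, cos_0, sin_0; f_equal; ring. Qed.

Lemma Cexp_neq_0 (z : C) : Cexp z <> RtoC 0.
Proof.
  intros E. apply C1_nz. rewrite <- Cexp_0.
  replace (RtoC 0) with (z + - z)%C by ring.
  rewrite Cexp_plus, E. ring.
Qed.

(** Integrating a bound of the form [|f' t| <= M |t|^n] raises the exponent by
    one; repeated use gives the Taylor remainders below without series. *)
Lemma bound_of_derive_bound (f f' : R -> R) (M : R) (n : nat) :
  f 0 = 0 ->
  (forall t, is_derive f t (f' t)) ->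
  (forall t, Rabs t <= 1 -> Rabs (f' t) <= M * Rabs t ^ n) ->
  forall x, Rabs x <= 1 -> Rabs (f x) <= M * Rabs x ^ S n.
Proof.
  intros f0 df bf x hx.
  destruct (MVT_gen f 0 x f') as [c [hc E]].
  - intros; apply df.
  - intros t _. apply continuity_pt_filterlim.
    apply (ex_derive_continuous f t). exists (f' t); apply df.
  - rewrite f0, !Rminus_0_r in E. rewrite E, Rabs_mult; simpl.
    assert (hcx : Rabs c <= Rabs x).
    { revert hc; unfold Rmin, Rmax; destruct (Rle_dec 0 x); intros hc;
        unfold Rabs; repeat destruct Rcase_abs; lra. }
    assert (M0 : 0 <= M).
    { assert (H1 := bf 1). rewrite Rabs_R1, pow1 in H1.
      generalize (Rabs_pos (f' 1)). lra. }
    replace (M * (Rabs x * Rabs x ^ n)) with ((M * Rabs x ^ n) * Rabs x) by ring.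
    apply Rmult_le_compat_r; [apply Rabs_pos|].
    apply Rle_trans with (M * Rabs c ^ n).
    + apply bf; lra.
    + apply Rmult_le_compat_l; [exact M0|].
      apply pow_incr; split; [apply Rabs_pos|exact hcx].
Qed.

Lemma exp_remainder (x : R) :
  Rabs x <= 1 -> Rabs (exp x - 1 - x - x ^ 2 / 2) <= 3 * Rabs x ^ 3.
Proof.
  revert x.
  apply (bound_of_derive_bound (fun x => exp x - 1 - x - x ^ 2 / 2)
           (fun x => exp x - 1 - x)).
  { rewrite exp_0; field. }
  { intros t; auto_derive; [easy|]; simpl; field. }
  apply (bound_of_derive_bound (fun x => exp x - 1 - x) (fun x => exp x - 1)).
  { rewrite exp_0; ring. }
  { intros t; auto_derive; [easy|]; ring. }
  apply (bound_of_derive_bound (fun x => exp x - 1) (fun x => exp x)).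
  { rewrite exp_0; ring. }
  { intros t; auto_derive; [easy|]; ring. }
  intros t ht. rewrite Rabs_pos_eq by (left; apply exp_pos).
  assert (exp t <= exp 1).
  { destruct (Req_dec t 1) as [->|]; [lra|].
    left; apply exp_increasing. revert ht; unfold Rabs; destruct Rcase_abs; lra. }
  generalize exp_le_3; simpl; lra.
Qed.

Lemma cos_sin_remainder (y : R) :
  Rabs y <= 1 ->
  Rabs (sin y - y) <= 1 * Rabs y ^ 3 /\ Rabs (cos y - 1 + y ^ 2 / 2) <= 1 * Rabs y ^ 4.
Proof.
  assert (B1 : forall x, Rabs x <= 1 -> Rabs (sin x) <= 1 * Rabs x ^ 1).
  { apply (bound_of_derive_bound sin cos); [apply sin_0| |].
    - intros t; auto_derive; [easy|]; ring.
    - intros t _; simpl. generalize (COS_bound t).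
      unfold Rabs; destruct Rcase_abs; lra. }
  assert (B2 : forall x, Rabs x <= 1 -> Rabs (cos x - 1) <= 1 * Rabs x ^ 2).
  { apply (bound_of_derive_bound (fun x => cos x - 1) (fun x => - sin x)).
    - rewrite cos_0; ring.
    - intros t; auto_derive; [easy|]; ring.
    - intros t ht; rewrite Rabs_Ropp; auto. }
  assert (B3 : forall x, Rabs x <= 1 -> Rabs (sin x - x) <= 1 * Rabs x ^ 3).
  { apply (bound_of_derive_bound (fun x => sin x - x) (fun x => cos x - 1)); auto.
    - rewrite sin_0; ring.
    - intros t; auto_derive; [easy|]; ring. }
  intros hy; split; [auto|]. revert y hy.
  apply (bound_of_derive_bound (fun x => cos x - 1 + x ^ 2 / 2) (fun x => - (sin x - x))).
  - rewrite cos_0; field.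
  - intros t; auto_derive; [easy|]; simpl; field.
  - intros t ht; rewrite Rabs_Ropp; auto.
Qed.

Lemma Cexp_remainder (w : C) :
  Cmod w <= 1 -> Cmod (Cexp w - 1 - w - w ^ 2 / 2)%C <= 20 * Cmod w ^ 3.
Proof.
  intros hw.
  assert (hx := re_le_Cmod w). assert (hy := im_le_Cmod w).
  set (r := Cmod w) in *. assert (r0 : 0 <= r) by apply Cmod_ge_0.
  destruct w as [x y]; simpl in hx, hy; fold r.
  assert (Ex := exp_remainder x ltac:(lra)).
  destruct (cos_sin_remainder y ltac:(lra)) as [Es Ec].
  assert (P : forall t n, Rabs t <= r -> Rabs t ^ n <= r ^ n)
    by (intros; apply pow_incr; split; [apply Rabs_pos|easy]).
  assert (Px := P x 3%nat hx). assert (Py := P y 3%nat hy).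
  assert (Py4 : Rabs y ^ 4 <= r ^ 3).
  { apply Rle_trans with (1 := P y 4%nat hy).
    replace (r ^ 4) with (r ^ 3 * r) by ring.
    rewrite <- (Rmult_1_r (r ^ 3)) at 2.
    apply Rmult_le_compat_l; [apply pow_le|]; assumption. }
  set (q := r ^ 3) in *.
  assert (q0 : 0 <= q) by (apply pow_le; exact r0).
  set (r1 := exp x - 1 - x - x ^ 2 / 2) in *.
  set (r2 := cos y - 1 + y ^ 2 / 2) in *.
  set (r3 := sin y - y) in *.
  assert (Hr1 : Rabs r1 <= 3 * q) by lra.
  assert (Hr2 : Rabs r2 <= q) by lra.
  assert (Hr3 : Rabs r3 <= q) by lra.
  assert (hx1 : Rabs x <= 1) by lra. assert (hy1 : Rabs y <= 1) by lra.
  assert (He : 0 < exp x <= 3).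
  { split; [apply exp_pos|]. apply Rle_trans with (2 := exp_le_3).
    destruct (Req_dec x 1) as [->|]; [lra|]. left; apply exp_increasing.
    apply Rabs_le_between in hx1; lra. }
  assert (Hxyy : Rabs (x * y ^ 2) <= q).
  { unfold q. rewrite Rabs_mult, <- RPow_abs.
    replace (r ^ 3) with (r * r ^ 2) by ring.
    apply Rmult_le_compat; auto using Rabs_pos. apply pow_le, Rabs_pos. }
  assert (Hxxy : Rabs (x ^ 2 * y) <= q).
  { unfold q. rewrite Rabs_mult, <- RPow_abs.
    replace (r ^ 3) with (r ^ 2 * r) by ring.
    apply Rmult_le_compat; auto using Rabs_pos. apply pow_le, Rabs_pos. }
  assert (T : forall a b A B, Rabs a <= A -> Rabs b <= B -> Rabs (a * b) <= A * B).
  { intros; rewrite Rabs_mult; apply Rmult_le_compat; auto using Rabs_pos. }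
  assert (Hx4 : Rabs (x * (x * y ^ 2)) <= q).
  { rewrite <- (Rmult_1_l q). apply T; auto. }
  assert (He' : Rabs (exp x) <= 3) by (rewrite Rabs_pos_eq; lra).
  apply Rle_trans with (1 := Cmod_le_Re_Im _).
  replace (Re (Cexp (x, y) - 1 - (x, y) - (x, y) ^ 2 / 2)%C)
    with (r2 * exp x + r1 * (1 - y ^ 2 / 2) - x * y ^ 2 / 2 - x * (x * y ^ 2) / 4).
  2: { unfold r1, r2, Cexp, Cminus, Cplus, Copp, Cdiv, Cmult, Cinv, RtoC; simpl; field. }
  replace (Im (Cexp (x, y) - 1 - (x, y) - (x, y) ^ 2 / 2)%C)
    with (r3 * exp x + r1 * y + x ^ 2 * y / 2).
  2: { unfold r1, r3, Cexp, Cminus, Cplus, Copp, Cdiv, Cmult, Cinv, RtoC; simpl; field. }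
  (* With r1, r2, r3 the real remainders, every remaining term is at most a
     multiple of r^3. *)
  assert (A1 := T _ _ _ _ Hr2 He').
  assert (A2 := T _ _ _ _ Hr3 He').
  assert (A3 := T _ _ _ _ Hr1 hy1).
  assert (A4 : Rabs (r1 * (1 - y ^ 2 / 2)) <= (3 * q) * 1).
  { apply T; auto. apply Rabs_le_between. apply Rabs_le_between in hy1. nra. }
  clearbody r1 r2 r3 q.
  assert (Rabs (r2 * exp x + r1 * (1 - y ^ 2 / 2) - x * y ^ 2 / 2 - x * (x * y ^ 2) / 4)
          <= 10 * q).
  { apply Rabs_le_between in A1, A4, Hxyy, Hx4. apply Rabs_le_between; lra. }
  assert (Rabs (r3 * exp x + r1 * y + x ^ 2 * y / 2) <= 10 * q).
  { apply Rabs_le_between in A2, A3, Hxxy. apply Rabs_le_between; lra. }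
  lra.
Qed.

Lemma Cexp_remainder_1 (w : C) :
  Cmod w <= 1 -> Cmod (Cexp w - 1 - w)%C <= 21 * Cmod w ^ 2.
Proof.
  intros hw. assert (H := Cexp_remainder w hw).
  replace (Cexp w - 1 - w)%C with ((Cexp w - 1 - w - w ^ 2 / 2) + w ^ 2 * (1/2)%R)%C
    by (rewrite RtoC_div by lra; field; intros E; injection E; lra).
  apply Rle_trans with (1 := Cmod_triangle _ _).
  rewrite Cmod_mult, Cmod_pow, Cmod_R, (Rabs_pos_eq (1/2)) by lra.
  assert (0 <= Cmod w) by apply Cmod_ge_0.
  assert (0 <= Cmod w ^ 2) by (apply pow_le; auto). simpl in *. nra.
Qed.

(** * Finite products and coordinatewise limits *)

Lemma Cprod_ext (f g : nat -> C) (n : nat) :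
  (forall j, f j = g j) -> Cprod n f = Cprod n g.
Proof. intros H; induction n as [|n IH]; simpl; [easy|]. now rewrite IH, H. Qed.

Lemma Cprod_mult (f g : nat -> C) (n : nat) :
  Cprod n (fun j => f j * g j)%C = (Cprod n f * Cprod n g)%C.
Proof. induction n as [|n IH]; simpl; [ring|]. rewrite IH; ring. Qed.

Lemma Cprod_neq_0 (f : nat -> C) (n : nat) :
  (forall j, f j <> RtoC 0) -> Cprod n f <> RtoC 0.
Proof.
  intros H; induction n as [|n IH]; simpl; [apply C1_nz|].
  now apply Cmult_neq_0.
Qed.

Lemma Cprod_S_l (f : nat -> C) (n : nat) :
  Cprod (S n) f = (f 0%nat * Cprod n (fun j => f (S j)))%C.
Proof.
  induction n as [|n IH]; [simpl; ring|].
  change (Cprod (S n) f * f (S n) = f 0%nat * (Cprod n (fun j => f (S j)) * f (S n)))%C.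
  rewrite IH; ring.
Qed.

(** The differences [s j - s (S j)] are automatically nonnegative under the
    hypothesis. *)
Lemma Cprod_near_1 (f : nat -> C) (s : nat -> R) (n : nat) :
  (forall j, (j < n)%nat -> Cmod (f j - 1)%C <= exp (s j - s (S j)) - 1) ->
  Cmod (Cprod n f - 1)%C <= exp (s 0%nat - s n) - 1.
Proof.
  induction n as [|n IH]; intros H; simpl.
  - rewrite Rminus_diag, exp_0. replace (1 - 1)%C with (RtoC 0) by ring.
    rewrite Cmod_0; lra.
  - assert (I := IH (fun j hj => H j (Nat.lt_trans _ _ _ hj (Nat.lt_succ_diag_r n)))).
    assert (J := H n (Nat.lt_succ_diag_r n)).
    replace (s 0%nat - s (S n)) with ((s 0%nat - s n) + (s n - s (S n))) by ring.
    rewrite exp_plus.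
    set (p := Cprod n f) in *. set (q := f n) in *.
    replace (p * q - 1)%C with ((p - 1) * (q - 1) + (p - 1) + (q - 1))%C by ring.
    assert (T := Cmod_triangle ((p - 1) * (q - 1) + (p - 1)) (q - 1)).
    assert (T' := Cmod_triangle ((p - 1) * (q - 1)) (p - 1)).
    rewrite Cmod_mult in T'.
    assert (0 <= Cmod (p - 1)) by apply Cmod_ge_0.
    assert (0 <= Cmod (q - 1)) by apply Cmod_ge_0.
    nra.
Qed.

(** Convergence of the real and imaginary parts to finite limits, which is when
    [Clim_seq] is the limit in the plane. *)
Definition ex_Clim_seq (u : nat -> C) : Prop :=
  ex_finite_lim_seq (fun n => Re (u n)) /\ ex_finite_lim_seq (fun n => Im (u n)).

Lemma ex_Clim_seq_mult (u v : nat -> C) :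
  ex_Clim_seq u -> ex_Clim_seq v -> ex_Clim_seq (fun n => u n * v n)%C.
Proof.
  intros [[a Ha] [b Hb]] [[c Hc] [d Hd]]; split.
  - exists (a * c - b * d). unfold Cmult, Re at 1; simpl.
    apply is_lim_seq_minus'; now apply is_lim_seq_mult'.
  - exists (a * d + b * c). unfold Cmult, Im at 1; simpl.
    apply is_lim_seq_plus'; now apply is_lim_seq_mult'.
Qed.

Lemma ex_Clim_seq_incr_1 (u : nat -> C) :
  ex_Clim_seq u -> ex_Clim_seq (fun n => u (S n)).
Proof.
  intros [[a Ha] [b Hb]]; split; [exists a|exists b];
    now apply (is_lim_seq_incr_1 (fun n => _ (u n))).
Qed.

(** A sequence whose increments are dominated by those of a nonnegative
    decreasing sequence [s] converges, since [x + s] is decreasing and bounded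
    below. *)
Lemma ex_finite_lim_seq_of_increments (x s : nat -> R) :
  (forall n, Rabs (x (S n) - x n) <= s n - s (S n)) -> (forall n, 0 <= s n) ->
  ex_finite_lim_seq x.
Proof.
  intros H s0.
  assert (Hd : forall n, s (S n) <= s n).
  { intros n. generalize (H n) (Rabs_pos (x (S n) - x n)); lra. }
  destruct (ex_finite_lim_seq_decr s 0 Hd s0) as [ls Hs].
  assert (Hl : forall n, x 0%nat - s 0%nat <= x n - s n).
  { induction n as [|n IH]; [lra|]. generalize (proj1 (Rabs_le_between _ _) (H n)); lra. }
  destruct (ex_finite_lim_seq_decr (fun n => x n + s n) (x 0%nat - s 0%nat))
    as [l Hx].
  - intros n. generalize (proj1 (Rabs_le_between _ _) (H n)); lra.
  - intros n. generalize (Hl n) (s0 n); lra.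
  - exists (l - ls). apply is_lim_seq_ext with (fun n => (x n + s n) - s n).
    + intros; ring.
    + now apply is_lim_seq_minus'.
Qed.

(** No convergence of [u] is required: [Lim_seq] is monotone, so a bounded
    sequence has its [Lim_seq] within the same bounds. *)
Lemma Lim_seq_dist (u v : nat -> R) (e : R) :
  (forall n, Rabs (u n - v n) <= e) -> ex_finite_lim_seq v ->
  Rabs (real (Lim_seq u) - real (Lim_seq v)) <= e.
Proof.
  intros H [l Hl].
  assert (E : Lim_seq v = l) by now apply is_lim_seq_unique.
  assert (Hp : is_lim_seq (fun n => v n + e) (l + e))
    by (apply is_lim_seq_plus'; [easy|apply is_lim_seq_const]).
  assert (Hm : is_lim_seq (fun n => v n - e) (l - e))
    by (apply is_lim_seq_minus'; [easy|apply is_lim_seq_const]).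
  assert (U : Rbar_le (Lim_seq u) (l + e)).
  { rewrite <- (is_lim_seq_unique _ _ Hp). apply Lim_seq_le_loc.
    exists 0%nat; intros n _. generalize (proj1 (Rabs_le_between _ _) (H n)); lra. }
  assert (D : Rbar_le (l - e) (Lim_seq u)).
  { rewrite <- (is_lim_seq_unique _ _ Hm). apply Lim_seq_le_loc.
    exists 0%nat; intros n _. generalize (proj1 (Rabs_le_between _ _) (H n)); lra. }
  rewrite E. destruct (Lim_seq u) as [x| |]; simpl in *; try easy.
  apply Rabs_le_between; lra.
Qed.

Lemma Clim_seq_dist (u v : nat -> C) (e : R) :
  (forall n, Cmod (u n - v n)%C <= e) -> ex_Clim_seq v ->
  Cmod (Clim_seq u - Clim_seq v)%C <= 2 * e.
Proof.
  intros H [Hr Hi].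
  apply Rle_trans with (1 := Cmod_le_Re_Im _).
  replace (2 * e) with (e + e) by ring.
  apply Rplus_le_compat; unfold Clim_seq; simpl.
  - apply Lim_seq_dist; [|easy]. intros n.
    apply Rle_trans with (2 := H n). apply (re_le_Cmod (u n - v n)).
  - apply Lim_seq_dist; [|easy]. intros n.
    apply Rle_trans with (2 := H n). apply (im_le_Cmod (u n - v n)).
Qed.

Lemma Clim_seq_neq_0 (u : nat -> C) (b : R) :
  0 < b -> eventually (fun n => b <= Cmod (u n)) -> ex_Clim_seq u ->
  Clim_seq u <> RtoC 0.
Proof.
  intros b0 [N HN] [[x Hx] [y Hy]] E.
  unfold Clim_seq in E.
  rewrite (is_lim_seq_unique _ _ Hx), (is_lim_seq_unique _ _ Hy) in E.
  injection E; intros -> ->; simpl in *.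
  apply is_lim_seq_abs in Hx, Hy. simpl in Hx, Hy. rewrite Rabs_R0 in Hx, Hy.
  assert (L := is_lim_seq_plus' _ _ _ _ Hx Hy).
  assert (Rbar_le b (0 + 0)) as B.
  { rewrite <- (is_lim_seq_unique _ _ L), <- (Lim_seq_const b).
    apply Lim_seq_le_loc. exists N; intros n hn.
    apply Rle_trans with (1 := HN n hn), Cmod_le_Re_Im. }
  simpl in B; lra.
Qed.

Lemma inv_square_le_telescope (K : R) (j : nat) :
  0 <= K -> K / (INR j + 1) ^ 2 <= 2 * K / (INR j + 1) - 2 * K / (INR (S j) + 1).
Proof.
  intros HK. rewrite S_INR. generalize (pos_INR j); intros Hj.
  replace (2 * K / (INR j + 1) - 2 * K / (INR j + 1 + 1))
    with (K / (INR j + 1) ^ 2 + K * INR j / ((INR j + 1) ^ 2 * (INR j + 2)))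
    by (field; lra).
  assert (0 <= K * INR j / ((INR j + 1) ^ 2 * (INR j + 2))); [|lra].
  apply Rmult_le_pos; [nra|]. left; apply Rinv_0_lt_compat.
  apply Rmult_lt_0_compat; [apply pow_lt|]; lra.
Qed.

Lemma Rle_exp_minus_1 (x y : R) : x <= y -> x <= exp y - 1.
Proof. generalize (exp_ineq1_le y); lra. Qed.

Lemma exp_le (x y : R) : x <= y -> exp x <= exp y.
Proof. intros [H| ->]; [left; now apply exp_increasing|lra]. Qed.

Lemma Cprod_near_1_of_square (f : nat -> C) (K : R) (n : nat) :
  0 <= K -> (forall j, Cmod (f j - 1)%C <= K / (INR j + 1) ^ 2) ->
  Cmod (Cprod n f - 1)%C <= exp (2 * K) - 1.
Proof.
  intros K0 H.
  apply Rle_trans with (exp (2 * K / (INR 0 + 1) - 2 * K / (INR n + 1)) - 1).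
  - apply (Cprod_near_1 f (fun j => 2 * K / (INR j + 1))).
    intros j _. apply Rle_exp_minus_1.
    apply Rle_trans with (1 := H j). now apply inv_square_le_telescope.
  - apply Rplus_le_compat_r, exp_le.
    assert (0 <= 2 * K / (INR n + 1)).
    { apply Rmult_le_pos; [lra|]. left; apply Rinv_0_lt_compat.
      generalize (pos_INR n); lra. }
    simpl; lra.
Qed.

Lemma Cmod_le_1_plus (p : C) : Cmod p <= 1 + Cmod (p - 1)%C.
Proof.
  replace p with (1 + (p - 1))%C at 1 by ring.
  apply Rle_trans with (1 := Cmod_triangle _ _). rewrite Cmod_1; lra.
Qed.

Lemma Cprod_converges (f : nat -> C) (K : R) :
  0 <= K -> (forall j, Cmod (f j - 1)%C <= K / (INR j + 1) ^ 2) ->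
  ex_Clim_seq (fun n => Cprod n f).
Proof.
  intros K0 H.
  set (s := fun n => exp (2 * K) * (2 * K / (INR n + 1))).
  assert (s0 : forall n, 0 <= s n).
  { intros n. apply Rmult_le_pos; [left; apply exp_pos|].
    apply Rmult_le_pos; [lra|]. left; apply Rinv_0_lt_compat.
    generalize (pos_INR n); lra. }
  assert (I : forall n, Cmod (Cprod (S n) f - Cprod n f)%C <= s n - s (S n)).
  { intros n. simpl Cprod.
    replace (Cprod n f * f n - Cprod n f)%C with (Cprod n f * (f n - 1))%C by ring.
    rewrite Cmod_mult. unfold s. rewrite <- Rmult_minus_distr_l.
    apply Rmult_le_compat; try apply Cmod_ge_0.
    - generalize (Cmod_le_1_plus (Cprod n f)) (Cprod_near_1_of_square f K n K0 H); lra.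
    - apply Rle_trans with (1 := H n). now apply inv_square_le_telescope. }
  split; apply ex_finite_lim_seq_of_increments with s; auto; intros n;
    apply Rle_trans with (2 := I n).
  - apply (re_le_Cmod (Cprod (S n) f - Cprod n f)).
  - apply (im_le_Cmod (Cprod (S n) f - Cprod n f)).
Qed.

Lemma bounded_of_eventually_bounded (e : nat -> R) (K : R) (J : nat) :
  (forall j, (J <= j)%nat -> e j <= K) -> exists M, 0 < M /\ forall j, e j <= M.
Proof.
  revert K; induction J as [|J IH]; intros K H.
  - exists (Rmax 1 K); split; [apply Rlt_le_trans with (2 := Rmax_l _ _); lra|].
    intros j. apply Rle_trans with (2 := Rmax_r _ _), H; lia.
  - apply IH with (Rmax K (e J)). intros j hj.
    destruct (Nat.eq_dec j J) as [->|]; [apply Rmax_r|].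
    apply Rle_trans with (2 := Rmax_l _ _), H; lia.
Qed.

(** * The Gauss sequence *)

(** A regular point has a distance to [- j] that is bounded below by a multiple
    of [j + 1], uniformly in [j]. *)
Lemma Gamma_regular_bound (a : C) :
  Gamma_regular a -> exists M, 0 < M /\ forall j, INR j + 1 <= M * Cmod (a + INR j)%C.
Proof.
  intros Ha.
  assert (Hp : forall j, 0 < Cmod (a + INR j)%C).
  { intros j. apply Cmod_gt_0. intros E. apply (Ha j).
    replace a with ((a + INR j) - INR j)%C by ring. rewrite E; ring. }
  destruct (nfloor_ex (2 * Cmod a + 1)) as [J [_ HJ]].
  { generalize (Cmod_ge_0 a); lra. }
  destruct (bounded_of_eventually_bounded
              (fun j => (INR j + 1) / Cmod (a + INR j)%C) 2 (S J)) as [M [M0 HM]].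
  - intros j hj. apply Rle_div_l; [apply Hp|].
    assert (INR (S J) <= INR j) by now apply le_INR. rewrite S_INR in *.
    assert (T := Cmod_triangle (a + INR j) (- a)). rewrite Cmod_opp in T.
    replace (a + INR j + - a)%C with (RtoC (INR j)) in T by ring.
    rewrite Cmod_R, Rabs_pos_eq in T by apply pos_INR. lra.
  - exists M; split; [easy|]. intros j. apply Rle_div_l; [apply Hp|apply HM].
Qed.

Lemma Gamma_regular_neq_0 (a : C) (j : nat) :
  Gamma_regular a -> (a + INR j)%C <> RtoC 0.
Proof.
  intros Ha E. apply (Ha j).
  replace a with ((a + INR j) - INR j)%C by ring. rewrite E; ring.
Qed.

Lemma ln_0 : ln 0 = 0.
Proof. unfold ln. destruct (Rlt_dec 0 0) as [H|H]; [now elim (Rlt_irrefl 0)|easy]. Qed.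

(** The increments of [ln]; they telescope to [ln n].  Since [ln 0 = 0], both
    [ln_step 0] and [ln_step 1] vanish. *)
Definition ln_step (j : nat) : R := ln (INR j) - ln (INR (pred j)).

Lemma ln_step_bounds (j : nat) :
  0 < INR j -> / (INR j + 1) <= ln_step (S j) <= / INR j.
Proof.
  intros Hj. unfold ln_step. rewrite S_INR; simpl pred.
  assert (E : forall x, 0 < x -> ln x <= x - 1).
  { intros x Hx. generalize (exp_ineq1_le (ln x)). rewrite exp_ln; lra. }
  rewrite <- ln_div by lra. split.
  - rewrite <- (Rinv_inv ((INR j + 1) / INR j)), ln_Rinv.
    2: { apply Rinv_0_lt_compat, Rdiv_lt_0_compat; lra. }
    assert (H := E (/ ((INR j + 1) / INR j))).
    replace (/ ((INR j + 1) / INR j) - 1) with (- / (INR j + 1)) in H by (field; lra).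
    assert (0 < / ((INR j + 1) / INR j)); [|lra].
    apply Rinv_0_lt_compat, Rdiv_lt_0_compat; lra.
  - replace (/ INR j) with ((INR j + 1) / INR j - 1) by (field; lra).
    apply E, Rdiv_lt_0_compat; lra.
Qed.

Lemma ln_step_le (j : nat) : Rabs (ln_step j) <= 3 / (INR j + 1).
Proof.
  destruct j as [|[|j]].
  - unfold ln_step; simpl. rewrite Rminus_diag, Rabs_R0; lra.
  - unfold ln_step; simpl. rewrite ln_0, ln_1, Rminus_diag, Rabs_R0; lra.
  - assert (0 < INR (S j)) by (apply lt_0_INR; lia).
    assert (B := ln_step_bounds (S j) H).
    rewrite (S_INR (S j)).
    assert (0 < / (INR (S j) + 1)) by (apply Rinv_0_lt_compat; lra).
    rewrite Rabs_pos_eq by lra.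
    apply Rle_trans with (1 := proj2 B).
    assert (1 <= INR (S j)) by (rewrite S_INR; generalize (pos_INR j); lra).
    apply Rle_div_r; [lra|].
    apply Rmult_le_reg_l with (INR (S j)); [lra|].
    rewrite <- Rmult_assoc, Rinv_r by lra. lra.
Qed.

Lemma ln_step_approx (a : C) :
  Gamma_regular a ->
  exists K, 0 < K /\
    forall j, Cmod (RtoC (ln_step j) - / (a + INR j))%C <= K / (INR j + 1) ^ 2.
Proof.
  intros Ha.
  destruct (Gamma_regular_bound a Ha) as [M [M0 HM]].
  destruct (bounded_of_eventually_bounded
     (fun j => Cmod (RtoC (ln_step j) - / (a + INR j))%C * (INR j + 1) ^ 2)
     (6 + 2 * M * Cmod a) 2) as [K [K0 HK]].
  2: { exists K; split; [easy|]. intros j. apply Rle_div_r; [|apply HK].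
       apply pow_lt; generalize (pos_INR j); lra. }
  intros j hj.
  destruct j as [|[|i]]; [lia|lia|]. set (x := INR (S i)).
  assert (x1 : 1 <= x) by (unfold x; rewrite S_INR; generalize (pos_INR i); lra).
  assert (B := ln_step_bounds (S i)). specialize (HM (S (S i))).
  assert (N := Gamma_regular_neq_0 a (S (S i)) Ha).
  rewrite (S_INR (S i)) in *. fold x in B, HM, N |- *.
  specialize (B ltac:(lra)).
  assert (X0 : RtoC (x + 1) <> RtoC 0) by (intros E; injection E; lra).
  replace (RtoC (ln_step (S (S i))) - / (a + RtoC (x + 1)))%C
    with (RtoC (ln_step (S (S i)) - / (x + 1))
          + a * / (RtoC (x + 1) * (a + RtoC (x + 1))))%C.
  2: { rewrite RtoC_minus, RtoC_inv by lra. field; split; easy. }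
  apply Rle_trans with ((/ x - / (x + 1) + Cmod a * / ((x + 1) * Cmod (a + RtoC (x + 1))))
                         * (x + 1 + 1) ^ 2).
  - apply Rmult_le_compat_r; [apply pow2_ge_0|].
    apply Rle_trans with (1 := Cmod_triangle _ _).
    apply Rplus_le_compat.
    + rewrite Cmod_R, Rabs_pos_eq; lra.
    + rewrite Cmod_mult, Cmod_inv by now apply Cmult_neq_0.
      rewrite Cmod_mult, Cmod_R, (Rabs_pos_eq (x + 1)) by lra. lra.
  - set (y := Cmod (a + RtoC (x + 1))) in *.
    assert (y0 : 0 < y) by now apply Cmod_gt_0.
    rewrite Rmult_plus_distr_r. apply Rplus_le_compat.
    + replace ((/ x - / (x + 1)) * (x + 1 + 1) ^ 2) with ((x + 2) ^ 2 / (x * (x + 1)))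
        by (field; lra).
      apply Rle_div_l; nra.
    + assert (A0 := Cmod_ge_0 a).
      replace (Cmod a * / ((x + 1) * y) * (x + 1 + 1) ^ 2)
        with (Cmod a * ((x + 2) / (x + 1) * ((x + 2) / y))) by (field; lra).
      replace (6 + 2 * M * Cmod a - 6) with (Cmod a * (2 * M)) by ring.
      replace (2 * M * Cmod a) with (Cmod a * (2 * M)) by ring.
      apply Rmult_le_compat_l; [easy|].
      apply Rmult_le_compat.
      * apply Rlt_le, Rdiv_lt_0_compat; lra.
      * apply Rlt_le, Rdiv_lt_0_compat; lra.
      * apply Rle_div_l; lra.
      * apply Rle_div_l; lra.
Qed.

(** The sequence whose limit defines [CGamma]. *)
Definition Gauss_seq (z : C) (n : nat) : C :=
  (INR (fact n) * Rcpow (INR n) z / Cprod (S n) (fun j => z + INR j))%C.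

(** The factors of the quotient of the Gauss sequences at [a + h] and at [a];
    see [Gauss_seq_shift]. *)
Definition Gauss_ratio (a h : C) (j : nat) : C :=
  (Cexp (h * ln_step j) * / (1 + h * / (a + INR j)))%C.

Lemma Cprod_Cexp_ln_step (h : C) (n : nat) :
  Cprod (S n) (fun j => Cexp (h * ln_step j)) = Rcpow (INR n) h.
Proof.
  induction n as [|n IH].
  - unfold Rcpow, ln_step; simpl. rewrite ln_0, Rminus_diag, Cmult_0_r, Cexp_0; ring.
  - change (Cprod (S n) (fun j => Cexp (h * ln_step j)) * Cexp (h * ln_step (S n))
            = Rcpow (INR (S n)) h)%C.
    rewrite IH. unfold Rcpow. rewrite <- Cexp_plus. f_equal.
    unfold ln_step; cbn [pred]. rewrite RtoC_minus; ring.
Qed.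

Lemma Gauss_seq_shift (a h : C) (n : nat) :
  Gamma_regular a -> Gamma_regular (a + h)%C ->
  Gauss_seq (a + h)%C n = (Gauss_seq a n * Cprod (S n) (Gauss_ratio a h))%C.
Proof.
  intros Ha Hh.
  assert (E : (Cprod (S n) (fun j => a + h + INR j) * Cprod (S n) (Gauss_ratio a h)
           = Cprod (S n) (fun j => a + INR j) * Rcpow (INR n) h)%C).
  { rewrite <- Cprod_Cexp_ln_step, <- !Cprod_mult. apply Cprod_ext. intros j.
    assert (N1 := Gamma_regular_neq_0 _ j Ha).
    assert (N2 := Gamma_regular_neq_0 _ j Hh).
    unfold Gauss_ratio. field. split; [easy|].
    intros E; apply N2; rewrite <- E; ring. }
  assert (P1 : Cprod (S n) (fun j => a + INR j)%C <> RtoC 0)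
    by (apply Cprod_neq_0; intros; now apply Gamma_regular_neq_0).
  assert (P2 : Cprod (S n) (fun j => a + h + INR j)%C <> RtoC 0)
    by (apply Cprod_neq_0; intros; now apply Gamma_regular_neq_0).
  assert (A : Rcpow (INR n) (a + h) = (Rcpow (INR n) a * Rcpow (INR n) h)%C).
  { unfold Rcpow. rewrite <- Cexp_plus. f_equal; ring. }
  unfold Gauss_seq. rewrite A.
  set (Q := Cprod (S n) (Gauss_ratio a h)) in *.
  set (p1 := Cprod (S n) (fun j => a + INR j)%C) in *.
  set (p2 := Cprod (S n) (fun j => a + h + INR j)%C) in *.
  clearbody Q p1 p2.
  replace (Rcpow (INR n) h) with (p2 * Q / p1)%C by (rewrite E; field; easy).
  field; split; easy.
Qed.

(** The condition [|h| <= r (j + 1)] covers two regimes at once: all [j] when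
    [h] is small, and all large [j] when [h] is arbitrary. *)
Lemma Gauss_ratio_bound (a : C) :
  Gamma_regular a ->
  exists r K, 0 < r /\ 0 < K /\
    forall h j, Cmod h <= r * (INR j + 1) ->
      Cmod (Gauss_ratio a h j - 1)%C <= K * Cmod h * (1 + Cmod h) / (INR j + 1) ^ 2.
Proof.
  intros Ha.
  destruct (Gamma_regular_bound a Ha) as [M [M0 HM]].
  destruct (ln_step_approx a Ha) as [K1 [K0 HK]].
  assert (R0 : 0 < Rmin (/ 3) (/ (2 * M))).
  { apply Rmin_glb_lt; apply Rinv_0_lt_compat; lra. }
  (* The bound / 3 gives |h ln_step j| <= 1, and / (2 M) gives
     |h / (a + j)| <= 1 / 2.  The constant 189 is 21 * 3^2, from the quadratic
     remainder of Cexp and the bound on ln_step. *)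
  exists (Rmin (/ 3) (/ (2 * M))), (2 * (189 + K1)).
  split; [easy|]. split; [lra|].
  intros h j Hh. specialize (HM j). specialize (HK j).
  assert (N := Gamma_regular_neq_0 _ j Ha).
  assert (HL := ln_step_le j).
  set (x := INR j + 1) in *.
  assert (x0 : 0 < x) by (unfold x; generalize (pos_INR j); lra).
  assert (H0 := Cmod_ge_0 h).
  assert (Hh1 : Cmod h <= / 3 * x).
  { apply Rle_trans with (1 := Hh), Rmult_le_compat_r; [lra|apply Rmin_l]. }
  assert (Hh2 : Cmod h <= / (2 * M) * x).
  { apply Rle_trans with (1 := Hh), Rmult_le_compat_r; [lra|apply Rmin_r]. }
  set (m := (/ (a + INR j))%C) in *. set (L := ln_step j) in *.
  assert (Hm : Cmod m <= M / x).
  { unfold m. rewrite Cmod_inv by easy. apply Rle_div_r; [lra|].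
    assert (0 < Cmod (a + INR j)) by now apply Cmod_gt_0.
    apply Rmult_le_reg_l with (Cmod (a + INR j)); [lra|].
    rewrite <- Rmult_assoc, Rinv_r by lra. lra. }
  assert (Hhm : Cmod (h * m) <= / 2).
  { rewrite Cmod_mult.
    apply Rle_trans with ((/ (2 * M) * x) * (M / x)).
    - apply Rmult_le_compat; auto using Cmod_ge_0.
    - right; field; lra. }
  assert (HhL' : Cmod (h * L) <= Cmod h * (3 / x)).
  { rewrite Cmod_mult, Cmod_R. now apply Rmult_le_compat_l. }
  assert (HhL : Cmod (h * L) <= 1).
  { apply Rle_trans with (1 := HhL').
    apply Rle_trans with ((/ 3 * x) * (3 / x)).
    - apply Rmult_le_compat_r; [apply Rlt_le, Rdiv_lt_0_compat; lra|easy].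
    - right; field; lra. }
  assert (D : / 2 <= Cmod (1 + h * m)).
  { assert (T := Cmod_triangle (1 + h * m) (- (h * m))). rewrite Cmod_opp in T.
    replace (1 + h * m + - (h * m))%C with (RtoC 1) in T by ring.
    rewrite Cmod_1 in T. lra. }
  assert (N' : (1 + h * m)%C <> RtoC 0) by (apply Cmod_gt_0; lra).
  assert (Rem := Cexp_remainder_1 _ HhL).
  unfold Gauss_ratio. fold m L.
  replace (Cexp (h * L) * / (1 + h * m) - 1)%C
    with (((Cexp (h * L) - 1 - h * L) + h * (L - m)) * / (1 + h * m))%C
    by (field; easy).
  rewrite Cmod_mult, Cmod_inv by easy.
  assert (S1 : Cmod (Cexp (h * L) - 1 - h * L + h * (L - m))
            <= 189 * Cmod h ^ 2 / x ^ 2 + Cmod h * (K1 / x ^ 2)).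
  { apply Rle_trans with (1 := Cmod_triangle _ _). apply Rplus_le_compat.
    - apply Rle_trans with (1 := Rem).
      replace (189 * Cmod h ^ 2 / x ^ 2) with (21 * (Cmod h * (3 / x)) ^ 2) by (field; lra).
      apply Rmult_le_compat_l; [lra|]. apply pow_incr; split; [apply Cmod_ge_0|easy].
    - rewrite Cmod_mult. now apply Rmult_le_compat_l. }
  apply Rle_trans with ((189 * Cmod h ^ 2 / x ^ 2 + Cmod h * (K1 / x ^ 2)) * 2).
  - apply Rmult_le_compat; auto using Cmod_ge_0.
    + left; apply Rinv_0_lt_compat; lra.
    + rewrite <- (Rinv_inv 2). apply Rinv_le_contravar; lra.
  - replace ((189 * Cmod h ^ 2 / x ^ 2 + Cmod h * (K1 / x ^ 2)) * 2)
      with ((2 * (189 * Cmod h ^ 2 + K1 * Cmod h)) / x ^ 2) by (field; lra).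
    apply Rmult_le_compat_r; [left; apply Rinv_0_lt_compat, pow_lt; lra|]. nra.
Qed.

Lemma Gauss_ratio_square_bound (a h : C) :
  Gamma_regular a ->
  exists K, 0 < K /\ forall j, Cmod (Gauss_ratio a h j - 1)%C <= K / (INR j + 1) ^ 2.
Proof.
  intros Ha. destruct (Gauss_ratio_bound a Ha) as [r [K [r0 [K0 H]]]].
  assert (P : forall j, 0 < (INR j + 1) ^ 2)
    by (intros j; apply pow_lt; generalize (pos_INR j); lra).
  destruct (nfloor_ex (Cmod h / r)) as [J [_ HJ]].
  { apply Rmult_le_pos; [apply Cmod_ge_0|left; now apply Rinv_0_lt_compat]. }
  destruct (bounded_of_eventually_bounded
      (fun j => Cmod (Gauss_ratio a h j - 1)%C * (INR j + 1) ^ 2)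
      (K * Cmod h * (1 + Cmod h)) J) as [K' [K0' H']].
  - intros j hj. apply Rle_div_r; [apply P|]. apply H.
    apply le_INR in hj. apply Rlt_div_l in HJ; nra.
  - exists K'; split; [easy|]. intros j. apply Rle_div_r; [apply P|apply H'].
Qed.

Lemma Gamma_regular_1 : Gamma_regular 1.
Proof. intros n E. injection E. generalize (pos_INR n); lra. Qed.

Lemma Gauss_seq_1 (n : nat) : (0 < n)%nat -> Gauss_seq 1 n = RtoC (INR n / (INR n + 1)).
Proof.
  intros hn. assert (0 < INR n) by now apply lt_0_INR.
  assert (E : Cprod (S n) (fun j => 1 + INR j)%C = RtoC (INR (fact n) * (INR n + 1))).
  { clear. induction n as [|n IH].
    - simpl. rewrite Rplus_0_l, !Rmult_1_l. ring.
    - change (Cprod (S n) (fun j => 1 + INR j) * (1 + INR (S n))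
              = RtoC (INR (fact (S n)) * (INR (S n) + 1)))%C.
      rewrite IH, fact_simpl, mult_INR, S_INR, !RtoC_mult, !RtoC_plus. ring. }
  unfold Gauss_seq. rewrite E. unfold Rcpow. rewrite Cmult_1_l.
  replace (Cexp (ln (INR n))) with (RtoC (INR n)).
  - assert (F := INR_fact_neq_0 n).
    rewrite <- RtoC_mult, <- RtoC_div by (apply Rmult_integral_contrapositive; split; lra).
    f_equal; field; lra.
  - unfold Cexp, RtoC; simpl. rewrite exp_ln, cos_0, sin_0 by easy. f_equal; ring.
Qed.

Lemma Gauss_seq_converges (z : C) : Gamma_regular z -> ex_Clim_seq (Gauss_seq z).
Proof.
  intros Hz.
  destruct (Gauss_ratio_square_bound 1 (z - 1) Gamma_regular_1) as [K [K0 HK]].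
  assert (E : forall n, Gauss_seq z n
       = (Gauss_seq 1 n * Cprod (S n) (Gauss_ratio 1 (z - 1)))%C).
  { intros n. rewrite <- Gauss_seq_shift.
    - f_equal; ring.
    - apply Gamma_regular_1.
    - replace (1 + (z - 1))%C with z by ring; easy. }
  assert (P : ex_Clim_seq (fun n => Cprod (S n) (Gauss_ratio 1 (z - 1)))).
  { apply (ex_Clim_seq_incr_1 (fun n => Cprod n (Gauss_ratio 1 (z - 1)))).
    apply (Cprod_converges _ K); [lra|easy]. }
  assert (Q : ex_Clim_seq (Gauss_seq 1)).
  { split.
    - exists 1. apply is_lim_seq_ext_loc with (fun n => 1 - / (INR n + 1)).
      + exists 1%nat. intros n hn. rewrite Gauss_seq_1 by lia. simpl.
        field. generalize (pos_INR n); lra.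
      + replace (Finite 1) with (Finite (1 - 0)) by (f_equal; ring).
        apply is_lim_seq_minus'; [apply is_lim_seq_const|].
        replace (Finite 0) with (Rbar_inv p_infty) by easy.
        apply is_lim_seq_inv; [|easy].
        apply is_lim_seq_ext with (fun n => INR (S n)).
        * intros n; apply S_INR.
        * apply (is_lim_seq_incr_1 INR), is_lim_seq_INR.
    - exists 0. apply is_lim_seq_ext_loc with (fun n => 0).
      + exists 1%nat. intros n hn. rewrite Gauss_seq_1 by lia. easy.
      + apply is_lim_seq_const. }
  destruct (ex_Clim_seq_mult _ _ Q P) as [[x Hx] [y Hy]].
  split; [exists x|exists y].
  - apply is_lim_seq_ext with (2 := Hx). intros n; now rewrite E.
  - apply is_lim_seq_ext with (2 := Hy). intros n; now rewrite E.
Qed.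

Lemma CGamma_neq_0 (z : C) : Gamma_regular z -> CGamma z <> RtoC 0.
Proof.
  intros Hz.
  (* The Gauss sequence at 1 is that at z times a bounded product, hence the
     sequence at z stays away from 0. *)
  destruct (Gauss_ratio_square_bound z (1 - z) Hz) as [K [K0 HK]].
  apply (Clim_seq_neq_0 (Gauss_seq z) (/ 2 * / exp (2 * K))).
  - apply Rmult_lt_0_compat; apply Rinv_0_lt_compat; [lra|apply exp_pos].
  - exists 1%nat. intros n hn.
    assert (E : Gauss_seq 1 n = (Gauss_seq z n * Cprod (S n) (Gauss_ratio z (1 - z)))%C).
    { rewrite <- Gauss_seq_shift; try easy.
      - f_equal; ring.
      - replace (z + (1 - z))%C with (RtoC 1) by ring. apply Gamma_regular_1. }
    rewrite Gauss_seq_1 in E by lia.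
    apply (f_equal Cmod) in E. rewrite Cmod_mult, Cmod_R in E.
    assert (n1 : 1 <= INR n) by (apply (le_INR 1); easy).
    assert (/ 2 <= INR n / (INR n + 1)) by (apply Rle_div_r; lra).
    rewrite Rabs_pos_eq in E by lra.
    assert (B := Cmod_le_1_plus (Cprod (S n) (Gauss_ratio z (1 - z)))).
    assert (B' := Cprod_near_1_of_square _ K (S n) (Rlt_le _ _ K0) HK).
    assert (X := exp_pos (2 * K)).
    apply Rle_div_l; [easy|].
    apply Rle_trans with (1 := H). rewrite E.
    apply Rmult_le_compat_l; [apply Cmod_ge_0|lra].
  - now apply Gauss_seq_converges.
Qed.

(** * Continuity of complex functions *)

Local Notation CU := (AbsRing_UniformSpace C_AbsRing).

(** Neighbourhoods and continuity for the metric [Cmod]. *)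
Definition Clocally (a : C) (P : C -> Prop) : Prop :=
  @locally CU a P.

Definition Ccontinuous (f : C -> C) (a : C) : Prop :=
  @continuous CU CU f a.

Lemma Clocally_iff (a : C) (P : C -> Prop) :
  Clocally a P <-> exists d, 0 < d /\ forall z, Cmod (z - a)%C < d -> P z.
Proof.
  split.
  - intros [d Hd]. exists d; split; [apply cond_pos|]. intros z Hz; now apply Hd.
  - intros [d [d0 Hd]]. exists (mkposreal d d0). intros z Hz; now apply Hd.
Qed.

Lemma Ccontinuous_iff (f : C -> C) (a : C) :
  Ccontinuous f a <->
  forall e, 0 < e -> Clocally a (fun z => Cmod (f z - f a)%C < e).
Proof.
  unfold Ccontinuous, continuous. rewrite filterlim_locally. split.
  - intros H e e0. apply (H (mkposreal e e0)).
  - intros H e. apply (H e), cond_pos.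
Qed.

Lemma Clocally_and (a : C) (P Q : C -> Prop) :
  Clocally a P -> Clocally a Q -> Clocally a (fun z => P z /\ Q z).
Proof. apply filter_and. Qed.

Lemma Clocally_imp (a : C) (P Q : C -> Prop) :
  (forall z, P z -> Q z) -> Clocally a P -> Clocally a Q.
Proof. apply filter_imp. Qed.

Lemma Clocally_ball (a : C) (d : R) : 0 < d -> Clocally a (fun z => Cmod (z - a)%C < d).
Proof. intros d0. apply Clocally_iff. exists d; auto. Qed.

Lemma Ccontinuous_const (c a : C) : Ccontinuous (fun _ => c) a.
Proof. apply (@continuous_const CU CU). Qed.

Lemma Ccontinuous_id (a : C) : Ccontinuous (fun z => z) a.
Proof. apply (@continuous_id CU). Qed.

Lemma Ccontinuous_comp (f g : C -> C) (a : C) :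
  Ccontinuous f a -> Ccontinuous g (f a) -> Ccontinuous (fun z => g (f z)) a.
Proof. apply (@continuous_comp CU CU
  CU). Qed.

Lemma Ccontinuous_mult (f g : C -> C) (a : C) :
  Ccontinuous f a -> Ccontinuous g a -> Ccontinuous (fun z => f z * g z)%C a.
Proof. exact (@continuous_mult CU C_AbsRing f g a). Qed.

Lemma Ccontinuous_plus (f g : C -> C) (a : C) :
  Ccontinuous f a -> Ccontinuous g a -> Ccontinuous (fun z => f z + g z)%C a.
Proof. exact (@continuous_plus CU C_AbsRing (AbsRing_NormedModule C_AbsRing) f g a). Qed.

Lemma Ccontinuous_opp (f : C -> C) (a : C) :
  Ccontinuous f a -> Ccontinuous (fun z => - f z)%C a.
Proof. exact (@continuous_opp CU C_AbsRing (AbsRing_NormedModule C_AbsRing) f a). Qed.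

Lemma Ccontinuous_neq_0 (f : C -> C) (a : C) :
  Ccontinuous f a -> f a <> RtoC 0 -> Clocally a (fun z => Cmod (f a) / 2 < Cmod (f z)).
Proof.
  intros Hf N. apply Cmod_gt_0 in N.
  apply Clocally_imp with (2 := proj1 (Ccontinuous_iff f a) Hf (Cmod (f a) / 2) ltac:(lra)).
  intros z Hz.
  assert (T := Cmod_triangle (f z) (- (f z - f a))). rewrite Cmod_opp in T.
  replace (f z + - (f z - f a))%C with (f a) in T by ring. lra.
Qed.

Lemma Ccontinuous_inv (f : C -> C) (a : C) :
  Ccontinuous f a -> f a <> RtoC 0 -> Ccontinuous (fun z => / f z)%C a.
Proof.
  intros Hf N. assert (L := Ccontinuous_neq_0 f a Hf N).
  assert (b0 := proj1 (Cmod_gt_0 _) N). set (b := Cmod (f a)) in *.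
  apply Ccontinuous_iff. intros e e0.
  assert (d0 : 0 < e * (b * b / 2)) by (apply Rmult_lt_0_compat; nra).
  apply Clocally_imp
    with (2 := Clocally_and _ _ _ L (proj1 (Ccontinuous_iff f a) Hf _ d0)).
  intros z [Hz He].
  assert (Nz : f z <> RtoC 0) by (apply Cmod_gt_0; lra).
  replace (/ f z - / f a)%C with (- (f z - f a) * / (f z * f a))%C by (field; easy).
  rewrite Cmod_mult, Cmod_opp, Cmod_inv by now apply Cmult_neq_0.
  rewrite Cmod_mult. fold b. apply Rlt_div_l; nra.
Qed.

Lemma Cexp_continuous (a : C) : Ccontinuous Cexp a.
Proof.
  apply Ccontinuous_iff. intros e e0.
  assert (A0 := proj1 (Cmod_gt_0 _) (Cexp_neq_0 a)). set (A := Cmod (Cexp a)) in *.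
  assert (d0 : 0 < Rmin 1 (e / (22 * A))).
  { apply Rmin_glb_lt; [lra|]. apply Rdiv_lt_0_compat; lra. }
  apply Clocally_imp with (2 := Clocally_ball a _ d0).
  intros z Hz. set (h := (z - a)%C) in *.
  assert (H1 : Cmod h < 1) by (apply Rlt_le_trans with (1 := Hz), Rmin_l).
  assert (H2 : Cmod h < e / (22 * A)) by (apply Rlt_le_trans with (1 := Hz), Rmin_r).
  replace (Cexp z - Cexp a)%C with (Cexp a * ((Cexp h - 1 - h) + h))%C.
  2: { replace z with (a + h)%C at 1 by (unfold h; ring). rewrite Cexp_plus; ring. }
  rewrite Cmod_mult. fold A.
  assert (T := Cmod_triangle (Cexp h - 1 - h) h).
  assert (B := Cexp_remainder_1 h (Rlt_le _ _ H1)).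
  apply Rlt_div_r in H2; [|lra].
  assert (0 <= Cmod h) by apply Cmod_ge_0.
  assert (Cmod (Cexp h - 1 - h + h) <= 22 * Cmod h) by nra.
  nra.
Qed.

Lemma exp_minus_1_small (c e : R) :
  0 <= c -> 0 < e -> exists d, 0 < d /\ forall x, x < d -> exp (c * x) - 1 < e.
Proof.
  intros c0 e0.
  assert (L : 0 < ln (1 + e)) by (rewrite <- ln_1; apply ln_increasing; lra).
  exists (ln (1 + e) / (c + 1)). split; [apply Rdiv_lt_0_compat; lra|].
  intros x Hx. apply Rlt_div_r in Hx; [|lra].
  assert (exp (c * x) < 1 + e); [|lra].
  rewrite <- (exp_ln (1 + e)) by lra. apply exp_increasing.
  destruct (Rle_or_lt 0 x); nra.
Qed.

Lemma Gamma_regular_open (a : C) : Gamma_regular a -> Clocally a Gamma_regular.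
Proof.
  intros Ha. destruct (Gamma_regular_bound a Ha) as [M [M0 HM]].
  apply Clocally_iff. exists (/ M). split; [now apply Rinv_0_lt_compat|].
  intros z Hz n E. specialize (HM n). rewrite E in Hz.
  replace (- INR n - a)%C with (- (a + INR n))%C in Hz by ring.
  rewrite Cmod_opp in Hz. apply (Rmult_lt_compat_l M) in Hz; [|easy].
  rewrite Rinv_r in Hz by lra. generalize (pos_INR n); lra.
Qed.

Lemma ex_Clim_seq_bounded (u : nat -> C) :
  ex_Clim_seq u -> exists B, 0 < B /\ forall n, Cmod (u n) <= B.
Proof.
  intros [[x Hx] [y Hy]].
  destruct (filterlim_bounded (K := R_AbsRing) (V := R_NormedModule)
              (fun n => Re (u n)) (ex_intro _ x Hx)) as [B HB].
  destruct (filterlim_bounded (K := R_AbsRing) (V := R_NormedModule)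
              (fun n => Im (u n)) (ex_intro _ y Hy)) as [B' HB'].
  exists (1 + Rabs B + Rabs B'). split.
  - generalize (Rabs_pos B) (Rabs_pos B'); lra.
  - intros n. apply Rle_trans with (1 := Cmod_le_Re_Im _).
    specialize (HB n). specialize (HB' n).
    change (Rabs (Re (u n)) <= B) in HB. change (Rabs (Im (u n)) <= B') in HB'.
    generalize (Rle_abs B) (Rle_abs B'); lra.
Qed.

Lemma CGamma_continuous (a : C) : Gamma_regular a -> Ccontinuous CGamma a.
Proof.
  intros Ha.
  destruct (Gauss_ratio_bound a Ha) as [r [K [r0 [K0 HK]]]].
  assert (Ca := Gauss_seq_converges a Ha).
  destruct (ex_Clim_seq_bounded _ Ca) as [B [B0 HB]].
  apply Ccontinuous_iff. intros e e0.
  destruct (exp_minus_1_small (4 * K) (e / (4 * B))) as [d [d0 Hd]].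
  { lra. } { apply Rdiv_lt_0_compat; lra. }
  assert (m0 : 0 < Rmin (Rmin 1 r) d) by (apply Rmin_glb_lt; [apply Rmin_glb_lt|]; lra).
  apply Clocally_imp with
    (2 := Clocally_and _ _ _ (Gamma_regular_open a Ha) (Clocally_ball a _ m0)).
  intros z [Rz Hz]. set (h := (z - a)%C) in *.
  assert (Hz1 : Cmod h < d) by (apply Rlt_le_trans with (1 := Hz), Rmin_r).
  assert (Hz2 : Cmod h < Rmin 1 r) by (apply Rlt_le_trans with (1 := Hz), Rmin_l).
  assert (Hz3 : Cmod h < 1) by (apply Rlt_le_trans with (1 := Hz2), Rmin_l).
  assert (Hz4 : Cmod h < r) by (apply Rlt_le_trans with (1 := Hz2), Rmin_r).
  assert (H0 := Cmod_ge_0 h).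
  assert (D : forall n, Cmod (Gauss_seq z n - Gauss_seq a n)%C <= B * (e / (4 * B))).
  { intros n. replace z with (a + h)%C by (unfold h; ring).
    rewrite Gauss_seq_shift; [|easy|now replace (a + h)%C with z by (unfold h; ring)].
    replace (Gauss_seq a n * Cprod (S n) (Gauss_ratio a h) - Gauss_seq a n)%C
      with (Gauss_seq a n * (Cprod (S n) (Gauss_ratio a h) - 1))%C by ring.
    rewrite Cmod_mult. apply Rmult_le_compat; auto using Cmod_ge_0.
    apply Rle_trans with (2 := Rlt_le _ _ (Hd _ Hz1)).
    replace (4 * K * Cmod h) with (2 * (2 * K * Cmod h)) by ring.
    apply Cprod_near_1_of_square; [nra|]. intros j.
    assert (J := pos_INR j).
    apply Rle_trans with (K * Cmod h * (1 + Cmod h) / (INR j + 1) ^ 2).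
    - apply HK; nra.
    - apply Rmult_le_compat_r; [left; apply Rinv_0_lt_compat, pow_lt; lra|].
      assert (0 <= K * Cmod h) by nra. nra. }
  apply Rle_lt_trans with (1 := Clim_seq_dist _ _ _ D Ca).
  replace (2 * (B * (e / (4 * B)))) with (e / 2) by (field; lra). lra.
Qed.

(** * The Weierstrass product near the origin *)

(** The exponential cancels [1 + x] up to order two; the cubic error is what
    makes the double product converge. *)
Lemma elementary_factor_bound (x : C) :
  Cmod x <= / 2 ->
  Cmod ((1 + x) * Cexp (- x + x ^ 2 / 2) - 1)%C <= 60 * Cmod x ^ 3.
Proof.
  intros Hx. assert (X0 := Cmod_ge_0 x).
  set (w := (- x + x ^ 2 / 2)%C).
  assert (H2 : RtoC 2 <> RtoC 0) by (intros E; injection E; lra).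
  assert (Hw : Cmod w <= 5 / 4 * Cmod x).
  { unfold w. apply Rle_trans with (1 := Cmod_triangle _ _).
    rewrite Cmod_opp, Cmod_div, Cmod_pow, Cmod_R, Rabs_pos_eq by (easy || lra). nra. }
  assert (B := Cexp_remainder w ltac:(lra)).
  set (E := (Cexp w - 1 - w - w ^ 2 / 2)%C) in *.
  (* Expanding (1 + x) (1 + w + w^2 / 2) - 1, the terms in x and x^2 cancel. *)
  replace ((1 + x) * Cexp w - 1)%C
    with ((1 + x) * E + x ^ 3 * ((1 / 2)%R + x * ((- (3 / 8))%R + x * (1 / 8)%R)))%C.
  2: { unfold E, w. rewrite RtoC_opp, !RtoC_div by lra.
       set (y := Cexp _). field. }
  apply Rle_trans with (1 := Cmod_triangle _ _).
  rewrite !Cmod_mult, Cmod_pow.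
  assert (P : Cmod w ^ 3 <= (5 / 4 * Cmod x) ^ 3)
    by (apply pow_incr; split; [apply Cmod_ge_0|easy]).
  assert (T1 := Cmod_triangle 1 x). rewrite Cmod_1 in T1.
  assert (T2 : Cmod ((1 / 2)%R + x * ((- (3 / 8))%R + x * (1 / 8)%R))%C <= 1).
  { apply Rle_trans with (1 := Cmod_triangle _ _). rewrite Cmod_mult.
    assert (T := Cmod_triangle (- (3 / 8))%R (x * (1 / 8)%R)).
    rewrite Cmod_mult, !Cmod_R in T. rewrite Cmod_R.
    rewrite Rabs_left in T by lra. rewrite Rabs_pos_eq in T |- * by lra. nra. }
  assert (C3 : 0 <= Cmod x ^ 3) by now apply pow_le.
  replace ((5 / 4 * Cmod x) ^ 3) with (125 / 64 * Cmod x ^ 3) in P by field.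
  set (q := Cmod x ^ 3) in *. clearbody q.
  assert (G1 : Cmod (1 + x) * Cmod E <= 3 / 2 * (20 * (125 / 64 * q))).
  { apply Rmult_le_compat; try apply Cmod_ge_0; lra. }
  assert (G2 : q * Cmod ((1 / 2)%R + x * ((- (3 / 8))%R + x * (1 / 8)%R))%C <= q * 1)
    by (apply Rmult_le_compat_l; easy).
  lra.
Qed.

Lemma lattice_lower_bound (tau : R) (k l : nat) :
  Rmin tau 1 * (INR k + INR l) <= lattice tau k l.
Proof.
  unfold lattice. generalize (Rmin_l tau 1) (Rmin_r tau 1) (pos_INR k) (pos_INR l); nra.
Qed.

Lemma Barnes_factor_bound (tau : R) (z : C) (k l : nat) :
  0 < tau -> Cmod z <= Rmin tau 1 / 2 ->
  Cmod (Barnes_factor tau z k l - 1)%C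
    <= 120 * Cmod z / Rmin tau 1 / (INR k + INR l + 1) ^ 3.
Proof.
  intros Ht Hz.
  assert (LB := lattice_lower_bound tau k l).
  assert (t0 : 0 < Rmin tau 1) by (apply Rmin_glb_lt; lra).
  set (t := Rmin tau 1) in *.
  assert (z0 := Cmod_ge_0 z).
  assert (S0 : 0 <= INR k + INR l) by (generalize (pos_INR k) (pos_INR l); lra).
  assert (R0 : 0 <= 120 * Cmod z / t / (INR k + INR l + 1) ^ 3).
  { repeat apply Rmult_le_pos; try lra.
    - left; now apply Rinv_0_lt_compat.
    - left; apply Rinv_0_lt_compat, pow_lt; lra. }
  assert (Cases : (k = 0%nat /\ l = 0%nat) \/ 1 <= INR k + INR l).
  { destruct k as [|k]; [destruct l as [|l]; [now left|]|]; right; rewrite !S_INR;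
      [generalize (pos_INR l)|generalize (pos_INR k) (pos_INR l)]; simpl; lra. }
  destruct Cases as [[-> ->]|S1].
  - simpl Barnes_factor. replace (1 - 1)%C with (RtoC 0) by ring.
    now rewrite Cmod_0.
  - set (m := INR k + INR l) in *. set (w := lattice tau k l) in *.
    assert (w0 : 0 < w) by nra.
    assert (W0 : RtoC w <> RtoC 0) by (intros E; injection E; lra).
    assert (E : Barnes_factor tau z k l
              = ((1 + z / w) * Cexp (- (z / w) + (z / w) ^ 2 / 2))%C).
    { transitivity ((1 + z / w) * Cexp (- (z / w) + z ^ 2 / (2 * w ^ 2)))%C.
      - unfold m in S1; destruct k, l; try easy. simpl in S1; lra.
      - do 2 f_equal. field. easy. }
    rewrite E.
    assert (X : Cmod (z / w)%C <= Cmod z / (t * m)).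
    { rewrite Cmod_div, Cmod_R, Rabs_pos_eq by (easy || lra).
      apply Rmult_le_compat_l; [easy|]. apply Rinv_le_contravar; nra. }
    assert (X2 : Cmod z / (t * m) <= Cmod z * 2 / (t * (m + 1))).
    { apply Rle_div_l; [nra|].
      replace (Cmod z * 2 / (t * (m + 1)) * (t * m)) with (Cmod z * (2 * m / (m + 1)))
        by (field; lra).
      rewrite <- (Rmult_1_r (Cmod z)) at 1. apply Rmult_le_compat_l; [easy|].
      apply Rle_div_r; lra. }
    assert (X1 : Cmod (z / w)%C <= / 2).
    { apply Rle_trans with (1 := X). apply Rle_div_l; nra. }
    apply Rle_trans with (1 := elementary_factor_bound _ X1).
    assert (P : Cmod (z / w)%C ^ 3 <= (Cmod z * 2 / (t * (m + 1))) ^ 3)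
      by (apply pow_incr; split; [apply Cmod_ge_0|lra]).
    assert (Q : Cmod z ^ 2 / t ^ 2 <= / 4).
    { apply Rle_div_l; [apply pow_lt; lra|]. nra. }
    apply Rle_trans with (60 * (Cmod z * 2 / (t * (m + 1))) ^ 3); [lra|].
    replace (60 * (Cmod z * 2 / (t * (m + 1))) ^ 3)
      with (480 * (Cmod z ^ 2 / t ^ 2) * (Cmod z / t / (m + 1) ^ 3)) by (field; lra).
    replace (120 * Cmod z / t / (m + 1) ^ 3) with (120 * (Cmod z / t / (m + 1) ^ 3))
      by (field; lra).
    apply Rmult_le_compat_r; [|lra].
    replace (Cmod z / t / (m + 1) ^ 3) with (/ 120 * (120 * Cmod z / t / (m + 1) ^ 3))
      by (field; lra).
    apply Rmult_le_pos; [lra|easy].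
Qed.

Lemma inv_cube_le_telescope (A x : R) :
  0 <= A -> 1 <= x -> A / x ^ 3 <= 2 * A / x ^ 2 - 2 * A / (x + 1) ^ 2.
Proof.
  intros HA Hx.
  replace (2 * A / x ^ 2 - 2 * A / (x + 1) ^ 2)
    with (A / x ^ 3 + A * (3 * x ^ 2 - 1) / (x ^ 3 * (x + 1) ^ 2)) by (field; lra).
  assert (0 <= A * (3 * x ^ 2 - 1) / (x ^ 3 * (x + 1) ^ 2)); [|lra].
  apply Rmult_le_pos; [apply Rmult_le_pos; nra|].
  left; apply Rinv_0_lt_compat, Rmult_lt_0_compat; apply pow_lt; lra.
Qed.

(** Summing first over [l], the potential [2 A / (k + l + 1)^2] leaves
    [2 A / (k + 1)^2] for row [k]; the potential [4 A / (k + 1)] then handles the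
    rows. *)
Lemma Barnes_partial_prod_bound (tau : R) (z : C) (N : nat) :
  0 < tau -> Cmod z <= Rmin tau 1 / 2 ->
  Cmod (Cprod N (fun k => Cprod N (fun l => Barnes_factor tau z k l)) - 1)%C
    <= exp (480 / Rmin tau 1 * Cmod z) - 1.
Proof.
  intros Ht Hz.
  assert (t0 : 0 < Rmin tau 1) by (apply Rmin_glb_lt; lra).
  set (A := 120 * Cmod z / Rmin tau 1).
  assert (A0 : 0 <= A).
  { apply Rmult_le_pos; [generalize (Cmod_ge_0 z); lra|].
    left; now apply Rinv_0_lt_compat. }
  assert (Pos : forall x y, 0 <= x -> 0 < y -> 0 <= x / y).
  { intros x y Hx Hy. apply Rmult_le_pos; [easy|]. left; now apply Rinv_0_lt_compat. }
  replace (480 / Rmin tau 1 * Cmod z) with (4 * A) by (unfold A; field; lra).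
  assert (In : forall k, Cmod (Cprod N (fun l => Barnes_factor tau z k l) - 1)%C
                 <= exp (2 * A / (INR k + 1) ^ 2) - 1).
  { intros k. assert (K0 := pos_INR k).
    apply Rle_trans with
      (exp (2 * A / (INR k + INR 0 + 1) ^ 2 - 2 * A / (INR k + INR N + 1) ^ 2) - 1).
    - apply (Cprod_near_1 _ (fun l => 2 * A / (INR k + INR l + 1) ^ 2)).
      intros l _. apply Rle_exp_minus_1.
      apply Rle_trans with (1 := Barnes_factor_bound tau z k l Ht Hz). fold A.
      rewrite S_INR.
      replace (INR k + (INR l + 1) + 1) with ((INR k + INR l + 1) + 1) by ring.
      apply inv_cube_le_telescope; [easy|]. generalize (pos_INR l); lra.
    - apply Rplus_le_compat_r, exp_le. simpl INR at 2. rewrite Rplus_0_r.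
      assert (0 <= 2 * A / (INR k + INR N + 1) ^ 2); [|lra].
      apply Pos; [lra|]. apply pow_lt; generalize (pos_INR N); lra. }
  apply Rle_trans with (exp (4 * A / (INR 0 + 1) - 4 * A / (INR N + 1)) - 1).
  - apply (Cprod_near_1 _ (fun k => 4 * A / (INR k + 1))).
    intros k _. apply Rle_trans with (1 := In k). apply Rplus_le_compat_r, exp_le.
    replace (4 * A) with (2 * (2 * A)) by ring. apply inv_square_le_telescope; lra.
  - apply Rplus_le_compat_r, exp_le. simpl INR at 1.
    assert (0 <= 4 * A / (INR N + 1)); [|lra].
    apply Pos; [lra|]. generalize (pos_INR N); lra.
Qed.

Lemma Barnes_prod_near_1 (tau : R) (z : C) :
  0 < tau -> Cmod z <= Rmin tau 1 / 2 ->
  Cmod (Barnes_prod tau z - 1)%C <= 2 * (exp (480 / Rmin tau 1 * Cmod z) - 1).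
Proof.
  intros Ht Hz.
  replace (RtoC 1) with (Clim_seq (fun _ => RtoC 1)).
  - apply Clim_seq_dist.
    + intros N. now apply Barnes_partial_prod_bound.
    + split; [exists 1|exists 0]; apply is_lim_seq_const.
  - unfold Clim_seq; simpl. now rewrite !Lim_seq_const.
Qed.

Lemma Barnes_prod_0 (tau : R) : 0 < tau -> Barnes_prod tau 0 = RtoC 1.
Proof.
  intros Ht.
  assert (B := Barnes_prod_near_1 tau 0 Ht).
  rewrite Cmod_0, Rmult_0_r, exp_0, Rminus_diag, Rmult_0_r in B.
  assert (t0 : 0 < Rmin tau 1) by (apply Rmin_glb_lt; lra).
  apply Ceq_minus, Cmod_eq_0, Rle_antisym; [apply B; lra|apply Cmod_ge_0].
Qed.

Lemma Barnes_prod_continuous_0 (tau : R) : 0 < tau -> Ccontinuous (Barnes_prod tau) 0.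
Proof.
  intros Ht. apply Ccontinuous_iff. intros e e0.
  assert (t0 : 0 < Rmin tau 1) by (apply Rmin_glb_lt; lra).
  destruct (exp_minus_1_small (480 / Rmin tau 1) (e / 2)) as [d [d0 Hd]].
  { apply Rlt_le, Rdiv_lt_0_compat; lra. } { lra. }
  assert (m0 : 0 < Rmin (Rmin tau 1 / 2) d) by (apply Rmin_glb_lt; lra).
  apply Clocally_imp with (2 := Clocally_ball 0 _ m0). intros z Hz.
  rewrite Barnes_prod_0 by easy.
  replace (z - 0)%C with z in Hz by ring.
  assert (Hz1 : Cmod z < Rmin tau 1 / 2) by (apply Rlt_le_trans with (1 := Hz), Rmin_l).
  assert (Hz2 : Cmod z < d) by (apply Rlt_le_trans with (1 := Hz), Rmin_r).
  generalize (Barnes_prod_near_1 tau z Ht (Rlt_le _ _ Hz1)) (Hd _ Hz2); lra.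
Qed.

(** * Simple zeros and multiplicative shifts *)

(** [f] vanishes at [a] and factors near [a] as [f z = (z - a) * h z], with [h]
    continuous at [a] and [h a = d]: the Caratheodory form of [f a = 0] and
    [f' a = d]. *)
Definition zero_with_slope (f : C -> C) (a d : C) : Prop :=
  exists h : C -> C,
    Ccontinuous h a /\ h a = d /\ Clocally a (fun z => f z = (z - a) * h z)%C.

Lemma zero_with_slope_eq_0 (f : C -> C) (a d : C) : zero_with_slope f a d -> f a = RtoC 0.
Proof.
  intros [h [_ [_ H]]]. apply Clocally_iff in H as [e [e0 H]].
  rewrite H; [ring|]. replace (a - a)%C with (RtoC 0) by ring. now rewrite Cmod_0.
Qed.

Lemma zero_with_slope_is_derive (f : C -> C) (a d : C) :
  zero_with_slope f a d -> @is_derive C_AbsRing C_NormedModule f a d.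
Proof.
  intros Hf. assert (F0 := zero_with_slope_eq_0 _ _ _ Hf).
  destruct Hf as [h [Hh [Ha H]]].
  split.
  - apply (is_linear_scal_l (K := C_AbsRing) (V := C_NormedModule)).
  - intros x Hx.
    assert (x = a) as ->.
    { symmetry.
      apply (is_filter_lim_locally_unique (K := C_AbsRing) (V := AbsRing_NormedModule C_AbsRing)).
      exact Hx. }
    intros e.
    apply Clocally_imp
      with (2 := Clocally_and _ _ _ H (proj1 (Ccontinuous_iff h a) Hh e (cond_pos e))).
    intros z [Ez Hz].
    change (Cmod (f z - f a - (z - a) * d)%C <= e * Cmod (z - a)%C).
    rewrite F0, Ez, <- Ha.
    replace ((z - a) * h z - 0 - (z - a) * h a)%C with ((h z - h a) * (z - a))%C by ring.
    rewrite Cmod_mult. apply Rmult_le_compat_r; [apply Cmod_ge_0|lra].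
Qed.

Lemma zero_with_slope_shift (f g : C -> C) (a s d : C) :
  zero_with_slope f (a + s)%C d -> Ccontinuous g a -> g a <> RtoC 0 ->
  Clocally a (fun z => f (z + s) = g z * f z)%C ->
  zero_with_slope f a (d / g a)%C.
Proof.
  intros [h [Hh [Ea H]]] Hg Ng Hfg.
  assert (Ts : Ccontinuous (fun z => z + s)%C a)
    by (apply Ccontinuous_plus; [apply Ccontinuous_id|apply Ccontinuous_const]).
  exists (fun z => h (z + s) * / g z)%C. split; [|split].
  - apply Ccontinuous_mult.
    + now apply (Ccontinuous_comp (fun z => z + s)%C h).
    + now apply Ccontinuous_inv.
  - now rewrite Ea.
  - assert (H' : Clocally a (fun z => f (z + s) = (z + s - (a + s)) * h (z + s))%C)
      by exact (Ts _ H).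
    apply Clocally_imp with (2 := Clocally_and _ _ _ (Ccontinuous_neq_0 g a Hg Ng)
                                    (Clocally_and _ _ _ H' Hfg)).
    intros z [Nz [E1 E2]]. rewrite E1 in E2.
    assert (N : g z <> RtoC 0) by (apply Cmod_gt_0; generalize (Cmod_ge_0 (g a)); lra).
    replace (f z) with (g z * f z / g z)%C by (field; easy).
    rewrite <- E2. field; easy.
Qed.

Lemma zero_with_slope_BarnesG_0 (tau c1 c2 : R) :
  0 < tau -> zero_with_slope (BarnesG tau c1 c2) 0 (1 / tau)%C.
Proof.
  intros Ht.
  exists (fun z => 1 / tau * (Cexp (c1 * z / tau + c2 * z ^ 2 / (2 * tau ^ 2))
                              * Barnes_prod tau z))%C.
  split; [|split].
  - apply Ccontinuous_mult; [apply Ccontinuous_const|].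
    apply Ccontinuous_mult; [|now apply Barnes_prod_continuous_0].
    apply (Ccontinuous_comp (fun z => c1 * z / tau + c2 * z ^ 2 / (2 * tau ^ 2))%C Cexp);
      [|apply Cexp_continuous].
    unfold Cdiv; simpl Cpow.
    repeat lazymatch goal with
      | |- Ccontinuous (fun _ => ?c) _ => exact (Ccontinuous_const c _)
      | |- Ccontinuous (fun z => z) _ => exact (Ccontinuous_id _)
      | |- Ccontinuous (fun z => Cplus (@?f z) (@?g z)) _ => apply (Ccontinuous_plus f g)
      | |- Ccontinuous (fun z => Cmult (@?f z) (@?g z)) _ => apply (Ccontinuous_mult f g)
      end.
  - rewrite Barnes_prod_0 by easy.
    replace (c1 * 0 / tau + c2 * 0 ^ 2 / (2 * tau ^ 2))%C with (RtoC 0)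
      by (unfold Cdiv; simpl; ring).
    rewrite Cexp_0; ring.
  - apply Clocally_iff. exists 1; split; [lra|]. intros z _.
    unfold BarnesG, Cdiv. ring.
Qed.

(** * The zeros of the double gamma function *)

Lemma Gamma_regular_RtoC (x : R) :
  (forall n, x <> - INR n) -> Gamma_regular x.
Proof. intros H n E. rewrite <- RtoC_opp in E. injection E. apply H. Qed.

Lemma irrational_neq_INR_div (x : R) (m n : nat) :
  irrational x -> (0 < m)%nat -> INR m * x <> INR n.
Proof.
  intros Hx Hm E. apply Hx. exists (Z.of_nat n), (Z.of_nat m). split; [lia|].
  rewrite <- !INR_IZR_INZ, <- E. field. apply not_0_INR; lia.
Qed.

(** The points met on the walk by steps of [tau]. *)
Lemma Gamma_regular_tau_multiple (tau : R) (l : nat) :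
  irrational tau -> Gamma_regular (- (INR (S l) * tau))%R.
Proof.
  intros Ht. apply Gamma_regular_RtoC. intros n E.
  apply (irrational_neq_INR_div tau (S l) n Ht); [lia|lra].
Qed.

(** The points [z / tau] met on the walk by unit steps. *)
Lemma Gamma_regular_inv_tau (tau : R) (l k : nat) :
  0 < tau -> irrational tau -> Gamma_regular (- (INR l * tau + INR (S k)) / tau)%R.
Proof.
  intros T0 Ht. apply Gamma_regular_RtoC. intros n E.
  assert (K0 : 0 < INR (S k)) by (apply lt_0_INR; lia).
  assert (E' : (INR n - INR l) * tau = INR (S k)).
  { apply Rmult_eq_reg_r with (/ tau); [|apply Rinv_neq_0_compat; lra].
    replace ((INR n - INR l) * tau * / tau) with (- - INR n - INR l) by (field; lra).
    rewrite <- E. field; lra. }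
  assert (Hnl : (l < n)%nat) by (apply INR_lt; nra).
  rewrite <- minus_INR in E' by lia.
  apply (irrational_neq_INR_div tau (n - l) (S k) Ht); [lia|exact E'].
Qed.

(** The quotient [G (z + tau) / G z] prescribed by the second functional
    equation. *)
Definition tau_shift_factor (tau : R) (z : C) : C :=
  (Rcpow (2 * PI) ((tau - 1) / 2) * Rcpow tau (1 / 2 - z) * CGamma z)%C.

Lemma tau_shift_factor_continuous (tau : R) (a : C) :
  Gamma_regular a -> Ccontinuous (tau_shift_factor tau) a.
Proof.
  intros Ha. unfold tau_shift_factor.
  apply Ccontinuous_mult; [apply Ccontinuous_mult; [apply Ccontinuous_const|]|].
  - apply (Ccontinuous_comp (fun z => (1 / 2 - z) * ln tau)%C Cexp); [|apply Cexp_continuous].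
    apply Ccontinuous_mult; [|apply Ccontinuous_const].
    apply Ccontinuous_plus; [apply Ccontinuous_const|].
    apply Ccontinuous_opp, Ccontinuous_id.
  - now apply CGamma_continuous.
Qed.

Lemma tau_shift_factor_neq_0 (tau : R) (a : C) :
  Gamma_regular a -> tau_shift_factor tau a <> RtoC 0.
Proof.
  intros Ha. repeat apply Cmult_neq_0; try apply Cexp_neq_0. now apply CGamma_neq_0.
Qed.

Lemma D_tau_0_0 (tau : R) : D_tau tau 0 0 = RtoC 1.
Proof. unfold D_tau; simpl; ring. Qed.

(** Raising [l] inserts a new factor at index [0] and shifts the others, which
    depend on [l - i] only. *)
Lemma D_tau_S_0 (tau : R) (l : nat) :
  D_tau tau (S l) 0
    = (tau_shift_factor tau (- (INR (S l) * tau))%R * D_tau tau l 0)%C.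
Proof.
  unfold D_tau. rewrite Cprod_S_l. unfold tau_shift_factor.
  change (INR 0) with 0. simpl (Cprod 0 _).
  rewrite (Cprod_ext (fun j : nat =>
      Rcpow (2 * PI) ((tau - 1) / 2) * Rcpow tau (1 / 2 + (INR (S l) - INR (S j)) * tau) *
      CGamma ((INR (S j) - INR (S l)) * tau))%C
    (fun i : nat => Rcpow (2 * PI) ((tau - 1) / 2) * Rcpow tau (1 / 2 + (INR l - INR i) * tau) *
      CGamma ((INR i - INR l) * tau))%C).
  - replace (1 / 2 + (INR (S l) - 0) * tau)%C with (1 / 2 - (- (INR (S l) * tau))%R)%C
      by (rewrite RtoC_opp, RtoC_mult; unfold Cdiv; ring).
    replace ((0 - INR (S l)) * tau)%C with (RtoC (- (INR (S l) * tau)))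
      by (rewrite RtoC_opp, RtoC_mult; ring).
    ring.
  - intros i. rewrite !S_INR, !RtoC_plus.
    do 3 f_equal; ring.
Qed.

Lemma D_tau_S_r (tau : R) (l k : nat) :
  0 < tau ->
  D_tau tau l (S k) = (CGamma (- (INR l * tau + INR (S k)) / tau)%R * D_tau tau l k)%C.
Proof.
  intros T0. unfold D_tau. rewrite Cprod_S_l.
  assert (N : RtoC tau <> RtoC 0) by (intros E; injection E; lra).
  rewrite (Cprod_ext (fun j : nat => CGamma ((INR (S j) - INR (S k)) / tau - INR l)%C)
    (fun j : nat => CGamma ((INR j - INR k) / tau - INR l)%C)).
  - replace ((INR 0 - INR (S k)) / tau - INR l)%C
      with (RtoC (- (INR l * tau + INR (S k)) / tau)).
    + ring.
    + rewrite RtoC_div, RtoC_opp, RtoC_plus, RtoC_mult by lra. change (INR 0) with 0.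
      field; easy.
  - intros j. rewrite !S_INR, !RtoC_plus. f_equal; field; easy.
Qed.

Lemma slope_step (tau : R) (g D : C) :
  0 < tau -> g <> RtoC 0 -> D <> RtoC 0 -> (1 / (tau * D) / g)%C = (1 / (tau * (g * D)))%C.
Proof.
  intros T0 Ng ND. assert (RtoC tau <> RtoC 0) by (intros E; injection E; lra).
  field; repeat split; easy.
Qed.

Lemma BarnesG_zero_tau_multiple (tau c1 c2 : R) (l : nat) :
  0 < tau -> irrational tau -> Barnes_constants tau c1 c2 ->
  D_tau tau l 0 <> RtoC 0 /\
  zero_with_slope (BarnesG tau c1 c2) (- (INR l * tau))%R (1 / (tau * D_tau tau l 0))%C.
Proof.
  intros T0 Ht [_ Hc]. induction l as [|l [ND IH]].
  - rewrite D_tau_0_0, Cmult_1_r. split; [apply C1_nz|].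
    simpl INR. rewrite Rmult_0_l, Ropp_0. now apply zero_with_slope_BarnesG_0.
  - assert (Rg := Gamma_regular_tau_multiple tau l Ht).
    assert (Ng := tau_shift_factor_neq_0 tau _ Rg).
    rewrite D_tau_S_0. split; [now apply Cmult_neq_0|].
    rewrite <- slope_step by easy.
    apply zero_with_slope_shift with (g := tau_shift_factor tau) (s := RtoC tau); trivial.
    + rewrite <- RtoC_plus.
      replace (- (INR (S l) * tau) + tau) with (- (INR l * tau)) by (rewrite S_INR; ring).
      exact IH.
    + now apply tau_shift_factor_continuous.
    + apply Clocally_imp with (2 := Gamma_regular_open _ Rg). exact Hc.
Qed.

Lemma BarnesG_zero (tau c1 c2 : R) (l k : nat) :
  0 < tau -> irrational tau -> Barnes_constants tau c1 c2 ->
  D_tau tau l k <> RtoC 0 /\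
  zero_with_slope (BarnesG tau c1 c2) (- (INR l * tau + INR k))%R
    (1 / (tau * D_tau tau l k))%C.
Proof.
  intros T0 Ht Hc.
  assert (N : RtoC tau <> RtoC 0) by (intros E; injection E; lra).
  induction k as [|k [ND IH]].
  - simpl INR. rewrite Rplus_0_r. now apply BarnesG_zero_tau_multiple.
  - destruct Hc as [Hc _].
    assert (Rg := Gamma_regular_inv_tau tau l k T0 Ht).
    assert (Ng := CGamma_neq_0 _ Rg).
    rewrite D_tau_S_r by easy. split; [now apply Cmult_neq_0|].
    rewrite <- slope_step by easy.
    rewrite RtoC_div in Rg, Ng |- * by lra.
    assert (Cd : Ccontinuous (fun z => z / tau)%C (- (INR l * tau + INR (S k)))%R)
      by (apply Ccontinuous_mult; [apply Ccontinuous_id|apply Ccontinuous_const]).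
    apply zero_with_slope_shift with (g := fun z => CGamma (z / tau)) (s := RtoC 1); trivial.
    + rewrite <- RtoC_plus.
      replace (- (INR l * tau + INR (S k)) + 1) with (- (INR l * tau + INR k))
        by (rewrite S_INR; ring).
      exact IH.
    + apply (Ccontinuous_comp (fun z => z / tau)%C CGamma); [easy|].
      now apply CGamma_continuous.
    + apply Clocally_imp with (P := fun z => Gamma_regular (z / tau)); [exact Hc|].
      exact (Cd _ (Gamma_regular_open _ Rg)).
Qed.

Theorem lemma2p2 (tau c1 c2 : R) (l k : nat)
  (tau_pos : (0 < tau)%R) (tau_irr : irrational tau)
  (Hc : Barnes_constants tau c1 c2) :
  let G := BarnesG tau c1 c2 in
  let rho : R := (INR l * tau + INR k)%R in
  simple_zero G (- RtoC rho)%C /\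
  @is_derive C_AbsRing C_NormedModule G (- RtoC rho)%C
    (1 / (RtoC tau * D_tau tau l k))%C.
Proof.
  intros G rho.
  destruct (BarnesG_zero tau c1 c2 l k tau_pos tau_irr Hc) as [ND Z].
  rewrite RtoC_opp in Z. fold G rho in Z.
  assert (N : RtoC tau <> RtoC 0) by (intros E; injection E; lra).
  assert (Der := zero_with_slope_is_derive _ _ _ Z).
  split; [split|exact Der].
  - exact (zero_with_slope_eq_0 _ _ _ Z).
  - eexists; split; [|exact Der].
    unfold Cdiv. rewrite Cmult_1_l. intros E.
    apply C1_nz. rewrite <- (Cinv_l (tau * D_tau tau l k)) by now apply Cmult_neq_0.
    rewrite E; ring.
Qed.
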